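(* Let $a>1$ be an integer, let $\lambda=(\lambda_1,\lambda_2)$ be a partition with two rows ($\lambda_1\ge\lambda_2\ge1$) and $a\le\lambda_1$, and let $\alpha=(1,a)$, $\beta=(2,1)$. Then $$e(P_\lambda;\alpha<\beta)=f^{(a-1)}f^{\lambda/(a)}=f^{\lambda/(a)},\qquad \mathbb{P}(P_\lambda;\alpha<\beta)=\frac{e(P_\lambda;\alpha<\beta)}{e(P_\lambda)}=\frac{f^{\lambda/(a)}}{f^\lambda}.$$ If $\lambda_2\le a$, then $$f^{\lambda/(a)}=\frac{(\lambda_1+\lambda_2-a)!}{(\lambda_1-a)!\,\lambda_2!},\qquad \frac{f^{\lambda/(a)}}{f^\lambda}=\frac{(\lambda_1+\lambda_2-a)!\,(\lambda_1+1)!}{(\lambda_1-a)!\,(\lambda_1+\lambda_2)!\,(1+\lambda_1-\lambda_2)}.$$ If $\lambda_2>a$, then $$f^{\lambda/(a)}=-\left(\frac{1}{(\lambda_2-a-1)!\,(\lambda_1+1)!}-\frac{1}{(\lambda_1-a)!\,\lambda_2!}\right)(\lambda_1+\lambda_2-a)!$$ and $$\frac{f^{\lambda/(a)}}{f^\lambda}=\frac{\bigl((\lambda_1+1)\,(\lambda_2-a-1)!\,\lambda_1!-\lambda_2\,(\lambda_1-a)!\,(\lambda_2-1)!\bigr)\,(\lambda_1+\lambda_2-a)!}{(\lambda_1-\lambda_2+1)\,(\lambda_1-a)!\,(\lambda_2-a-1)!\,(\lambda_1+\lambda_2)!}.$$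
   Context: The cell poset $P_\lambda$ of a partition $\lambda=(\lambda_1,\lambda_2)$ is the set of cells $(i,j)$ with $i\in\{1,2\}$, $1\le j\le\lambda_i$, ordered componentwise: $(i,j)\le(i',j')$ iff $i\le i'$ and $j\le j'$. For a subpartition $\mu\subseteq\lambda$ ($\mu_i\le\lambda_i$ for all $i$), $P_{\lambda/\mu}$ is the subposet of cells of $\lambda$ that are not cells of $\mu$. For a finite poset $Q$, $e(Q)$ is the number of linear extensions of $Q$ and $e(Q;\alpha<\beta)$ is the number of linear extensions placing $\alpha$ before $\beta$; $\mathbb{P}(Q;\alpha<\beta)=e(Q;\alpha<\beta)/e(Q)$. Put $f^\lambda=e(P_\lambda)$ and $f^{\lambda/\mu}=e(P_{\lambda/\mu})$ (numbers of standard Young tableaux of shape $\lambda$, respectively $\lambda/\mu$). One-row partitions are written $(m)$. *)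

(* Defs.v *)
From HB Require Import structures.
From mathcomp Require Import all_boot all_order all_algebra.

Set Implicit Arguments.
Unset Strict Implicit.
Unset Printing Implicit Defensive.

Import Order.TTheory GRing.Theory.

Definition subposet (d : Order.disp_t) (T : finPOrderType d) (A : {set T}) :=
  {x : T | x \in A}.

HB.instance Definition _
    (d : Order.disp_t) (T : finPOrderType d) (A : {set T}) :=
  SubFinite.on (subposet A).
HB.instance Definition _
    (d : Order.disp_t) (T : finPOrderType d) (A : {set T}) :=
  [SubChoice_isSubPOrder of subposet A by <: with d].

(* Positions are numbered from 0: f x is the number of elements placed
   before x. An injective f is a bijection, by cardinality. *)
Definition is_linear_extension (d : Order.disp_t) (Q : finPOrderType d)
    (f : {ffun Q -> 'I_#|Q|}) : bool :=
  injectiveb f && [forall x, forall y, (x <= y)%O ==> (f x <= f y)%N].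

Definition e (d : Order.disp_t) (Q : finPOrderType d) : nat :=
  #|[set f : {ffun Q -> 'I_#|Q|} | is_linear_extension f]|.

Definition e_lt (d : Order.disp_t) (Q : finPOrderType d) (x y : Q) : nat :=
  #|[set f : {ffun Q -> 'I_#|Q|} | is_linear_extension f & (f x < f y)%N]|.

Definition prob_lt (d : Order.disp_t) (Q : finPOrderType d) (x y : Q) : rat :=
  ((e_lt x y)%:R / (e Q)%:R)%R.

(* A partition with at most two rows is a pair (l1, l2) with l2 <= l1. *)
Definition row_length (lam : nat * nat) (i : nat) : nat :=
  match i with 1 => lam.1 | 2 => lam.2 | _ => 0 end.

Definition is_cell (lam : nat * nat) (i j : nat) : bool :=
  (1 <= i <= 2) && (1 <= j <= row_length lam i).

Definition one_row (m : nat) : nat * nat := (m, 0).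

(* Cells carry their 1-based coordinates; the index 0 is unused. When n is at
   least the first row of a partition, the box contains all of its cells. *)
Definition box (n : nat) := ('I_3 *p 'I_n.+1)%type.

Definition cells (n : nat) (lam : nat * nat) : {set box n} :=
  [set c : box n | is_cell lam c.1 c.2].

Definition skew_poset (lam mu : nat * nat) :=
  subposet (cells lam.1 lam :\: cells lam.1 mu).

Definition cell_poset (lam : nat * nat) := subposet (cells lam.1 lam).

Definition f_shape (lam : nat * nat) : nat := e (cell_poset lam).

Definition f_skew (lam mu : nat * nat) : nat := e (skew_poset lam mu).

Lemma cell_in_cells (lam : nat * nat) (i j : nat) :
  lam.2 <= lam.1 -> is_cell lam i j ->
  ((inord i, inord j) : box lam.1) \in cells lam.1 lam.
Proof.
move=> h; rewrite inE /is_cell /= => /andP[/andP[i1 i2] /andP[j1 j2]].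
rewrite !inordK ?i1 ?i2 ?j1 ?j2 // ltnS.
by case: i i1 i2 j2 => [|[|[|]]] //= _ _ /leq_trans; apply.
Qed.

Definition cell (lam : nat * nat) (i j : nat)
    (hlam : lam.2 <= lam.1) (hij : is_cell lam i j) : cell_poset lam :=
  exist _ ((inord i, inord j) : box lam.1) (cell_in_cells hlam hij).

Arguments cell lam i j hlam hij : clear implicits.

Lemma cellE (lam : nat * nat) (i j : nat)
    (hlam : lam.2 <= lam.1) (hij : is_cell lam i j) :
  ((val (cell lam i j hlam hij)).1 = i :> nat) *
  ((val (cell lam i j hlam hij)).2 = j :> nat).
Proof.
have /andP[/andP[i1 i2] /andP[j1 j2]] := hij; split; rewrite /= inordK //.
rewrite ltnS; move: i1 i2 j2; clear hij.
by case: i => [|[|[|]]] //= _ _ /leq_trans; apply.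
Qed.

Lemma le_cellE (lam mu : nat * nat) (c c' : skew_poset lam mu) :
  (c <= c')%O =
  ((val c).1 <= (val c').1)%N && ((val c).2 <= (val c').2)%N.
Proof. by []. Qed.

Lemma is_cell_first_row (l1 l2 a : nat) :
  1 < a -> a <= l1 -> is_cell (l1, l2) 1 a.
Proof. by move=> a1 al; rewrite /is_cell /= al (ltnW a1). Qed.

Lemma is_cell_second_row (l1 l2 : nat) : 1 <= l2 -> is_cell (l1, l2) 2 1.
Proof. by move=> h; rewrite /is_cell /= h. Qed.

(* Main.v *)
(* Linear extensions are encoded as orderings of the list of cells. Removing the
   first cell of an ordering of lambda/mu adds a cell to mu, so the orderings
   of lambda/mu are lattice paths from mu to lambda that stay weakly on one side
   of the diagonal. The recursion on the first cell yields the reflection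
   formula C(N, l2 - m2) - C(N, l1 + 1 - m2) with N = |lambda/mu|. Requiring
   alpha before beta forces the path to begin with a steps along the first row,
   which leaves exactly the paths for lambda/(a). *)
Require Import Defs.
From mathcomp Require Import all_boot all_order all_algebra.
From mathcomp Require Import zify ring.

Set Implicit Arguments.
Unset Strict Implicit.
Unset Printing Implicit Defensive.

Import GRing.Theory Num.Theory.

(** * Orderings of a list, counted by their first element *)

(** Here [r x y] means that [x] is allowed anywhere before [y]. All pairs are tested, not only
    adjacent ones, so [r] can be a non-transitive relation. *)
Definition orderings (K : eqType) (r : rel K) (s : seq K) : nat :=
  count (pairwise r) (permutations s).

Lemma eq_in_orderings (K : eqType) (r r' : rel K) (s : seq K) :
  {in s &, r =2 r'} -> orderings r s = orderings r' s.
Proof.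
move=> rr'; apply: eq_in_count => t; rewrite mem_permutations => ts.
apply: (@eq_in_pairwise _ (mem s)) => //.
by apply/allP => x; rewrite (perm_mem ts).
Qed.

(** The permutations are grouped by first element [x]; a group contributes nothing unless [x] may
    precede all the remaining elements. *)
Lemma orderings_rec (K : eqType) (r : rel K) (s : seq K) :
  uniq s -> 0 < size s ->
  orderings r s =
    \sum_(x <- s | all (r x) (rem x s)) orderings r (rem x s).
Proof.
move=> us s0; rewrite /orderings (permP (permutationsE s0)) undup_id //.
rewrite count_flatten -map_comp sumnE big_map [RHS]big_mkcond /=.
apply: eq_bigr => x _; rewrite count_map.
case: ifP => rx.
  apply: eq_in_count => t; rewrite mem_permutations => ts /=.
  by rewrite (perm_all _ ts) rx.
apply/eqP; rewrite -leqn0 leqNgt -has_count; apply/hasPn => t.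
by rewrite mem_permutations => ts /=; rewrite (perm_all _ ts) rx.
Qed.

Lemma rem_cat_notin (K : eqType) (x : K) (s t : seq K) :
  x \notin s -> rem x (s ++ t) = s ++ rem x t.
Proof.
elim: s => //= y s IHs; rewrite inE negb_or eq_sym => /andP[/negbTE-> /IHs ->].
by [].
Qed.

(** * Linear extensions as orderings of a list *)

Lemma pairwise_index (K : eqType) (r : rel K) (s : seq K) : uniq s ->
  reflect {in s &, forall x y, index x s < index y s -> r x y} (pairwise r s).
Proof.
case: s => [|x0 s] us; first by left.
apply: (iffP (pairwiseP x0)) => [H x y xs ys xy | H i j si sj ij].
  rewrite -(nth_index x0 xs) -(nth_index x0 ys).
  by apply: H; rewrite ?inE ?index_mem.
by apply: H; rewrite ?mem_nth ?index_uniq.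
Qed.

(** An ordering corresponds to the function sending each element to its index; the inverse lists the
    elements by increasing value. *)
Lemma card_orderings (Q : finType) (K : eqType) (h : Q -> K) (r : rel K)
    (s : seq K) :
  injective h -> perm_eq s [seq h x | x : Q] ->
  #|[set f : {ffun Q -> 'I_#|Q|} | injectiveb f &
      [forall x, forall y, (f x < f y) ==> r (h x) (h y)]]| = orderings r s.
Proof.
move=> hI sP.
(* The default [enum_rank x] is never reached when [t] is a permutation of [s], since every index is
   then below [#|Q|]. *)
pose g (t : seq K) : {ffun Q -> 'I_#|Q|} :=
  [ffun x => insubd (enum_rank x) (index (h x) t)].
have mem_perm t : perm_eq t s -> [/\ uniq t, size t = #|Q|,
    forall x, h x \in t & forall k, k \in t -> exists x, k = h x].
  move=> /perm_trans/(_ sP) tP; split.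
  - by rewrite (perm_uniq tP) map_inj_uniq ?enum_uniq.
  - by rewrite (perm_size tP) size_map cardE.
  - by move=> x; rewrite (perm_mem tP) map_f ?mem_enum.
  - by move=> k; rewrite (perm_mem tP) => /mapP[x _ ->]; exists x.
have gE t x : perm_eq t s -> g t x = index (h x) t :> nat.
  case/mem_perm => _ st ht _.
  rewrite ffunE val_insubd; case: ifP => // /negP[].
  by rewrite -st index_mem.
have g_inj : {in permutations s &, injective g}.
  move=> t u; rewrite !mem_permutations => ts us gtu.
  have [Ut St ht tE] := mem_perm _ ts; have [Uu Su hu uE] := mem_perm _ us.
  case: t => [|x0 t] in gtu ts Ut St ht tE *.
    by case: u Su {us hu Uu uE gtu} => //; rewrite -St.
  apply: (@eq_from_nth _ x0) => [|i it]; first by rewrite St.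
  have [x xE] := tE _ (mem_nth x0 it).
  have <- : index (h x) u = i by rewrite -gE // -gtu gE // -xE index_uniq.
  by rewrite nth_index // -gE // -gtu gE // nth_index.
rewrite /orderings -size_filter -(size_map g) cardE; apply/eqP.
apply/eqP/perm_size/uniq_perm; first exact: enum_uniq.
  rewrite map_inj_in_uniq ?filter_uniq ?permutations_uniq //.
  by move=> t u; rewrite !mem_filter => /andP[_ ?] /andP[_ ?]; apply: g_inj.
move=> f; rewrite mem_enum inE; apply/andP/mapP => [[/injectiveP fI fr]|].
  pose t := [seq h x | x <- sort (relpre f leq) (enum Q)].
  have ts : perm_eq t s.
    by rewrite perm_sym (perm_trans sP) // perm_map // perm_sym perm_sort.
  (* By bijectivity of [f], the sorted values are exactly 0, ..., [#|Q|] - 1, so each [x] sits at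
     index [f x]. *)
  have valfE : [seq val (f x) | x <- sort (relpre f leq) (enum Q)]
      = iota 0 #|Q|.
    apply: (sorted_eq leq_trans anti_leq); last 1 first.
    - apply: (@perm_trans _ [seq val (f x) | x <- enum Q]).
        by rewrite perm_map // perm_sort.
      rewrite map_comp -val_enum_ord perm_map //.
      apply: uniq_perm; rewrite ?(map_inj_uniq fI); try exact: enum_uniq.
      move=> i; rewrite mem_enum; apply/mapP.
      have [|f' _ f'K] := @inj_card_bij _ _ f fI; first by rewrite card_ord.
      by exists (f' i); rewrite ?mem_enum.
    - by rewrite sorted_map sort_sorted // => x y; apply: leq_total.
    - exact: iota_sorted.
  have ft : f = g t.
    apply/ffunP => x; apply/val_inj => /=; rewrite gE // index_map //.
    have valfI : injective (fun x => val (f x)).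
      by move=> y z /val_inj /fI.
    rewrite -(index_map valfI) valfE.
    have {1}-> : val (f x) = nth 0 (iota 0 #|Q|) (f x).
      by rewrite nth_iota ?add0n.
    by rewrite index_uniq ?size_iota ?iota_uniq.
  exists t => //; rewrite mem_filter mem_permutations ts andbT.
  have [Ut _ _ tE] := mem_perm _ ts.
  apply/pairwise_index => // _ _ /tE[x ->] /tE[y ->].
  rewrite -!gE // -ft => fxy.
  by move/forallP/(_ x)/forallP/(_ y): fr; rewrite fxy.
case=> t; rewrite mem_filter mem_permutations => /andP[rt ts] ->.
have [Ut _ ht _] := mem_perm _ ts; split.
  apply/injectiveP => x y /(congr1 val) /=; rewrite !gE //.
  by move=> /(index_inj (h x) (ht x) (ht y))/hI.
apply/forallP => x; apply/forallP => y; apply/implyP; rewrite !gE //.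
by apply/(pairwise_index _ Ut).
Qed.

(** Monotonicity is used in contrapositive form: if [f x < f y] then [y <= x] fails. *)
Lemma eE (d : Order.disp_t) (Q : finPOrderType d) (K : eqType) (h : Q -> K)
    (r : rel K) (s : seq K) :
  injective h -> perm_eq s [seq h x | x : Q] ->
  (forall x y, r (h x) (h y) = ~~ (y <= x)%O) -> e Q = orderings r s.
Proof.
move=> hI sP rP; rewrite -(card_orderings _ hI sP); apply: eq_card => f.
rewrite !inE; congr (_ && _).
apply/'forall_forallP/'forall_forallP => H x y; move: (H y x); rewrite rP.
  by rewrite ltnNge implybNN.
by rewrite ltnNge implybNN.
Qed.

(** The condition that [x] comes before [y] is absorbed into the relation by forbidding [y] before
    [x]; injectivity and [x != y] rule out a tie. *)
Lemma e_ltE (d : Order.disp_t) (Q : finPOrderType d) (K : eqType) (h : Q -> K)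
    (r : rel K) (s : seq K) (x y : Q) :
  injective h -> perm_eq s [seq h x | x : Q] ->
  (forall x y, r (h x) (h y) = ~~ (y <= x)%O) -> x != y ->
  e_lt x y =
    orderings (fun k l => r k l && ~~ ((k == h y) && (l == h x))) s.
Proof.
move=> hI sP rP xy; rewrite -(card_orderings _ hI sP); apply: eq_card => f.
rewrite !inE /is_linear_extension -andbA; case: injectiveP => //= fI.
apply/andP/'forall_forallP => [[/'forall_forallP H fxy] u v | H].
  apply/implyP => fuv; apply/andP; split.
    by move: (H v u); rewrite rP; apply: contraTN => ->; rewrite -ltnNge.
  apply/negP => /andP[/eqP/hI uy /eqP/hI vx].
  by move: fuv; rewrite uy vx ltnNge ltnW.
split.
  apply/'forall_forallP => u v; apply/implyP => uv.
  by rewrite leqNgt; apply/negP => fvu; move: (H v u); rewrite fvu rP uv.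
move: (H y x); rewrite !eqxx andbF implybF -leqNgt leq_eqVlt.
by case/predU1P => // /val_inj/fI/eqP; rewrite (negbTE xy).
Qed.

(** * Cells as lists of coordinates *)

Definition coords (n : nat) (A : {set box n}) (c : subposet A) : nat * nat :=
  ((val c).1 : nat, (val c).2 : nat).

Lemma coords_inj (n : nat) (A : {set box n}) : injective (@coords n A).
Proof.
move=> c d [c1 c2]; apply/val_inj.
rewrite [val c]surjective_pairing [val d]surjective_pairing.
by congr (_, _); apply: val_inj.
Qed.

Lemma perm_coords (n : nat) (A : {set box n}) (s : seq (nat * nat)) :
  uniq s -> {in s, forall k, (k.1 < 3) && (k.2 < n.+1)} ->
  (forall c : box n, (c \in A) = ((c.1 : nat, c.2 : nat) \in s)) ->
  perm_eq s [seq coords c | c : subposet A].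
Proof.
move=> us sb sA; apply: uniq_perm => //.
  by rewrite map_inj_uniq ?enum_uniq //; apply: coords_inj.
move=> k; apply/idP/mapP => [ks | [c _ ->]]; last by rewrite -sA (valP c).
have /andP[k1 k2] := sb _ ks.
have kA : ((inord k.1, inord k.2) : box n) \in A.
  by rewrite sA /= !inordK // -surjective_pairing.
exists (exist (fun c => c \in A) _ kA); first by rewrite mem_enum.
by rewrite /coords /= !inordK // -surjective_pairing.
Qed.

Definition row_cells (i m l : nat) : seq (nat * nat) :=
  [seq (i, j) | j <- iota m.+1 (l - m)].

(** Plain pairs of naturals keep the type fixed while [mu] grows along the recursion. *)
Definition skew_cells (lam mu : nat * nat) : seq (nat * nat) :=
  row_cells 1 mu.1 lam.1 ++ row_cells 2 mu.2 lam.2.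

(** This is the failure of [d <= c], so incomparable cells are allowed in both orders. *)
Definition may_precede (c d : nat * nat) : bool :=
  ~~ ((d.1 <= c.1) && (d.2 <= c.2)).

Lemma mem_row_cells (i m l i' j : nat) :
  ((i', j) \in row_cells i m l) = (i' == i) && (m < j <= l).
Proof.
apply/mapP/andP => [[k] | [/eqP-> jm]]; last first.
  by exists j => //; rewrite mem_iota; lia.
by rewrite mem_iota => kP [-> ->]; split; lia.
Qed.

Lemma mem_skew_cells (lam mu : nat * nat) (i j : nat) :
  ((i, j) \in skew_cells lam mu) = is_cell lam i j && ~~ is_cell mu i j.
Proof.
rewrite mem_cat !mem_row_cells /is_cell.
by case: i => [|[|[|i]]] //=; lia.
Qed.

Lemma uniq_skew_cells (lam mu : nat * nat) : uniq (skew_cells lam mu).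
Proof.
rewrite cat_uniq !map_inj_uniq ?iota_uniq; try by move=> ? ? [].
rewrite andbT; apply/hasPn => -[i j].
by rewrite !mem_row_cells => /andP[/eqP-> _].
Qed.

Lemma row_cellsS (i m l : nat) :
  m < l -> row_cells i m l = (i, m.+1) :: row_cells i m.+1 l.
Proof.
move=> ml; rewrite /row_cells subnS.
by case: (l - m) (subn_gt0 m l) => [|k]; rewrite ml.
Qed.

Lemma row_cells0 (i m l : nat) : l <= m -> row_cells i m l = [::].
Proof. by rewrite /row_cells -subn_eq0 => /eqP->. Qed.

Lemma perm_skew_poset (lam mu : nat * nat) : lam.2 <= lam.1 ->
  perm_eq (skew_cells lam mu) [seq coords c | c : skew_poset lam mu].
Proof.
move=> hl; apply: perm_coords => [||c]; first exact: uniq_skew_cells.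
  move=> [i j]; rewrite mem_skew_cells /is_cell => /andP[+ _] /=.
  by case: i => [|[|[|i]]] //=; lia.
by rewrite mem_skew_cells !inE andbC.
Qed.

Lemma perm_cell_poset (lam : nat * nat) : lam.2 <= lam.1 ->
  perm_eq (skew_cells lam (0, 0)) [seq coords c | c : cell_poset lam].
Proof.
move=> hl; apply: perm_coords => [||c]; first exact: uniq_skew_cells.
  move=> [i j]; rewrite mem_skew_cells /is_cell => /andP[+ _] /=.
  by case: i => [|[|[|i]]] //=; lia.
rewrite mem_skew_cells inE /is_cell; case: (val c.1) => [|[|[|i]]] //=; lia.
Qed.

Lemma f_skewE (lam mu : nat * nat) : lam.2 <= lam.1 ->
  f_skew lam mu = orderings may_precede (skew_cells lam mu).
Proof. by move=> hl; apply: eE (@coords_inj _ _) (perm_skew_poset _ hl) _. Qed.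

Lemma f_shapeE (lam : nat * nat) : lam.2 <= lam.1 ->
  f_shape lam = orderings may_precede (skew_cells lam (0, 0)).
Proof. by move=> hl; apply: eE (@coords_inj _ _) (perm_cell_poset hl) _. Qed.

(** * The lattice path recursion and the reflection formula *)

(** Only the first remaining cell of a row can come first. Allowing any [r] finer than [may_precede]
    covers both the plain count and the count with alpha before beta. *)
Lemma orderings_skew_cells_rec (r : rel (nat * nat)) (l1 l2 m1 m2 : nat) :
  subrel r may_precede -> (m1 < l1) || (m2 < l2) ->
  orderings r (skew_cells (l1, l2) (m1, m2)) =
    ((m1 < l1) && all (r (1, m1.+1)) (skew_cells (l1, l2) (m1.+1, m2))) *
      orderings r (skew_cells (l1, l2) (m1.+1, m2)) +
    ((m2 < l2) && all (r (2, m2.+1)) (skew_cells (l1, l2) (m1, m2.+1))) *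
      orderings r (skew_cells (l1, l2) (m1, m2.+1)).
Proof.
move=> rP m_lt.
have head i m l (s : seq (nat * nat)) :
    uniq s -> {subset row_cells i m l <= s} ->
    \sum_(x <- row_cells i m l | all (r x) (rem x s)) orderings r (rem x s) =
    ((m < l) && all (r (i, m.+1)) (rem (i, m.+1) s)) *
      orderings r (rem (i, m.+1) s).
  move=> us sub; case: (ltnP m l) => ml; last by rewrite row_cells0 // big_nil.
  rewrite row_cellsS // big_cons big1_seq => [|[i' j]].
    by case: ifP; rewrite ?mul1n ?addn0.
  rewrite mem_row_cells => /andP[/allP rs /andP[/eqP i'E jP]].
  rewrite {i'}i'E in rs *.
  (* A later cell [(i, j)] cannot come first: [(i, m.+1)] remains and lies below it. *)
  have im : (i, m.+1) \in rem (i, j) s.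
    rewrite mem_rem_uniq // !inE sub ?mem_row_cells ?eqxx /= ?ltnSn // andbT.
    by rewrite xpair_eqE negb_and; lia.
  by move: (rP _ _ (rs _ im)); rewrite /may_precede /=; lia.
have us := uniq_skew_cells (l1, l2) (m1, m2).
rewrite orderings_rec //; last by rewrite size_cat !size_map !size_iota /=; lia.
rewrite {1}/skew_cells big_cat /= (head 1 m1 l1 _ us); last first.
  by move=> x xr; rewrite mem_cat xr.
rewrite (head 2 m2 l2 _ us); last by move=> x xr; rewrite mem_cat xr orbT.
congr (_ + _); case: ltnP => //= ml.
  have -> : rem (1, m1.+1) (skew_cells (l1, l2) (m1, m2)) =
      skew_cells (l1, l2) (m1.+1, m2); last by [].
  by rewrite /skew_cells /= [in LHS]row_cellsS //= eqxx.
have -> : rem (2, m2.+1) (skew_cells (l1, l2) (m1, m2)) =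
    skew_cells (l1, l2) (m1, m2.+1); last by [].
rewrite /skew_cells /= rem_cat_notin ?mem_row_cells //.
by rewrite [X in rem _ X]row_cellsS //= eqxx.
Qed.

(* The first binomial coefficient is the number of bad paths of the reflection
   principle: those from (m1, m2) to the reflected endpoint (l2 - 1, l1 + 1). *)
Lemma orderings_skew_cells (l1 l2 m1 m2 : nat) :
  m2 <= m1 <= l1 -> m2 <= l2 <= l1 ->
  orderings may_precede (skew_cells (l1, l2) (m1, m2)) +
    'C(l1 - m1 + (l2 - m2), l1.+1 - m2) = 'C(l1 - m1 + (l2 - m2), l2 - m2).
Proof.
move Dn: (l1 - m1 + (l2 - m2)) => n.
elim: n => [|n IHn] in m1 m2 Dn * => m_le l_le.
  have -> : skew_cells (l1, l2) (m1, m2) = [::].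
    by rewrite /skew_cells !row_cells0 //=; lia.
  have [-> ->] : l2 - m2 = 0 /\ l1.+1 - m2 = (l1 - m2).+1 by lia.
  by [].
rewrite orderings_skew_cells_rec //; last lia.
have -> : all (may_precede (1, m1.+1)) (skew_cells (l1, l2) (m1.+1, m2)).
  by apply/allP => -[i j]; rewrite mem_cat !mem_row_cells /may_precede /=; lia.
(* A second-row step needs the cell above it to be gone already, that is [m2 < m1]. *)
have -> : (m2 < l2) &&
      all (may_precede (2, m2.+1)) (skew_cells (l1, l2) (m1, m2.+1)) =
    (m2 < l2) && (m2 < m1).
  case: (ltnP m2 l2) => //= m2l; apply/allP/idP => [H | m21 [i j]].
    case: (ltnP m1 l1) => [m1l|]; last lia.
    have /H : (1, m1.+1) \in skew_cells (l1, l2) (m1, m2.+1).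
      by rewrite mem_cat mem_row_cells eqxx ltnSn m1l.
    by rewrite /may_precede /=; lia.
  by rewrite mem_cat !mem_row_cells /may_precede /=; lia.
rewrite andbT.
have IH1 : m1 < l1 -> _ :=
  fun lt => IHn m1.+1 m2 ltac:(lia) ltac:(lia) ltac:(lia).
have IH2 : (m2 < l2) && (m2 < m1) -> _ :=
  fun lt => IHn m1 m2.+1 ltac:(lia) ltac:(lia) ltac:(lia).
have Dp : l1.+1 - m2 = (l1 - m2).+1 by lia.
have Dp1 : l1.+1 - m2.+1 = l1 - m2 by lia.
move: IH1 IH2; rewrite Dp Dp1.
case: (ltnP m1 l1) => m1l; last first.
  have -> : (m2 < l2) && (m2 < m1) by lia.
  move=> _ /(_ isT); rewrite /= mul0n mul1n add0n.
  rewrite (_ : l2 - m2 = (l2 - m2.+1).+1); last lia.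
  have := @bin_small n (l1 - m2).+1 ltac:(lia).
  have := @bin_small n (l2 - m2.+1).+1 ltac:(lia).
  by rewrite !binS; lia.
move=> /(_ isT).
case: (ltnP m2 l2) => m2l IH1; last first.
  move=> _; move: IH1; have -> : l2 - m2 = 0 by lia.
  by rewrite !bin0 /= mul1n mul0n addn0 !bin_small; lia.
(* Strictly off the diagonal both steps are open, and Pascal's rule on each binomial adds the two
   induction hypotheses. *)
case: (ltnP m2 m1) => m21 /=.
  move=> /(_ isT) IH2; move: IH1; rewrite /= !mul1n.
  by rewrite (_ : l2 - m2 = (l2 - m2.+1).+1) ?binS; lia.
move=> _; move: IH1; rewrite mul1n mul0n addn0 binS.
rewrite (_ : l2 - m2 = (l2 - m2.+1).+1) ?binS; last lia.
(* On the diagonal only the first-row step is open. The two Pascal terms left over agree by the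
   symmetry of binomials, which is where reflection enters. *)
have -> : l2 - m2.+1 = n - (l1 - m2) by lia.
by rewrite bin_sub; lia.
Qed.

(** * Orderings with alpha before beta *)

Lemma e_lt_cell (l1 l2 a : nat) (hl : l2 <= l1)
    (h1 : is_cell (l1, l2) 1 a) (h2 : is_cell (l1, l2) 2 1) :
  e_lt (cell (l1, l2) 1 a hl h1) (cell (l1, l2) 2 1 hl h2) =
    f_skew (l1, l2) (one_row a).
Proof.
set alpha := cell _ _ _ _ _; set beta := cell _ _ _ _ _.
have hA : coords alpha = (1, a) by rewrite /coords !cellE.
have hB : coords beta = (2, 1) by rewrite /coords !cellE.
have AB : alpha != beta by apply/eqP => /(congr1 (@coords _ _)); rewrite hA hB.
rewrite (e_ltE (@coords_inj _ _) (@perm_cell_poset (l1, l2) hl)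
  (r := may_precede)) //.
rewrite f_skewE // hA hB.
set r := fun k l => _; have rP : subrel r may_precede by move=> k l /andP[].
have al : a <= l1 by move: (h1); rewrite /is_cell /=; lia.
(* With alpha before beta, no cell of the second row can come first while a
   cell of (a) remains, so the cells of (a) come first, in order. *)
have step m : m <= a ->
    orderings r (skew_cells (l1, l2) (0, 0)) =
    orderings r (skew_cells (l1, l2) (m, 0)).
  elim: m => // m IHm ma; rewrite IHm ?(ltnW ma) //.
  rewrite orderings_skew_cells_rec //; last lia.
  have -> : (m < l1) && all (r (1, m.+1)) (skew_cells (l1, l2) (m.+1, 0)).
    apply/andP; split; first lia; apply/allP => -[i j].
    by rewrite mem_cat !mem_row_cells /r /may_precede !xpair_eqE /=; lia.
  have -> : all (r (2, 1)) (skew_cells (l1, l2) (m, 1)) = false.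
    apply/negP => /allP/(_ (1, a)).
    by rewrite mem_cat mem_row_cells eqxx ma al /r !eqxx andbF => /(_ isT).
  by rewrite andbF mul1n mul0n addn0.
(* Once the cells of [(a)] are removed, alpha is no longer in the list, so the forbidden pair cannot
   occur. *)
rewrite (step a) //; apply: eq_in_orderings => -[i j] [i' j'] _.
rewrite mem_cat !mem_row_cells /r !xpair_eqE => H.
have -> : ((i == 2) && (j == 1) && ((i' == 1) && (j' == a))) = false.
  by move: H => /=; lia.
by rewrite andbT.
Qed.

(** * Factorial formulas over the rationals *)

Local Open Scope ring_scope.

Lemma bin_factE (n k : nat) : (k <= n)%N ->
  'C(n, k)%:R = n`!%:R / (k`!%:R * (n - k)`!%:R) :> rat.
Proof.
move=> kn; rewrite -(bin_fact kn) !natrM mulfK //.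
by rewrite mulf_neq0 // pnatr_eq0 -lt0n fact_gt0.
Qed.

Lemma f_skew_one_row (l1 l2 a : nat) : (l2 <= l1)%N -> (a <= l1)%N ->
  (f_skew (l1, l2) (one_row a))%:R =
    'C(l1 + l2 - a, l2)%:R - 'C(l1 + l2 - a, l1.+1)%:R :> rat.
Proof.
move=> hl al; rewrite f_skewE // /one_row.
have := @orderings_skew_cells l1 l2 a 0; rewrite !subn0 -addnBAC //.
by move=> <- //; rewrite ?natrD ?addrK // al.
Qed.

(** The hook length formula for two rows, obtained from the reflection formula with [a = 0]. *)
Lemma f_shape_two_rows (l1 l2 : nat) : (l2 <= l1)%N ->
  (f_shape (l1, l2))%:R =
    (l1 + l2)`!%:R * (l1 - l2 + 1)%:R / (l1.+1`!%:R * l2`!%:R) :> rat.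
Proof.
move=> hl; have -> : f_shape (l1, l2) = f_skew (l1, l2) (one_row 0).
  by rewrite f_shapeE // f_skewE.
rewrite f_skew_one_row // subn0.
have f0 n : n`!%:R != 0 :> rat by rewrite pnatr_eq0 -lt0n fact_gt0.
(* For [l2 = 0] the second binomial vanishes and has no factorial form, since [l1.+1] exceeds
   [l1]. *)
case: l2 hl => [|k] hl.
  rewrite addn0 subn0 bin0 bin_small // fact0 addn1 factS natrM; field.
  by rewrite f0 nat1r pnatr_eq0.
rewrite !bin_factE; try lia.
rewrite addnK (_ : l1 + k.+1 - l1.+1 = k)%N; last lia.
have -> : (l1 - k.+1 + 1)%:R = l1%:R + 1 - k.+1%:R :> rat.
  by rewrite natrD natrB //; ring.
rewrite !factS !natrM -(natr1 l1); field.
  by rewrite !f0 ?nat1r ?natr1 ?pnatr_eq0.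
Qed.

Theorem theorem4p5 (a l1 l2 : nat)
    (ha : (1 < a)%N) (hl2 : (1 <= l2)%N) (hl : (l2 <= l1)%N)
    (hal : (a <= l1)%N) :
  let lam := (l1, l2) in
  let alpha := cell lam 1 a hl (is_cell_first_row l2 ha hal) in
  let beta := cell lam 2 1 hl (is_cell_second_row l1 hl2) in
  [/\ [/\ e_lt alpha beta = (f_shape (one_row (a - 1)) * f_skew lam (one_row a))%N,
          (f_shape (one_row (a - 1)) * f_skew lam (one_row a))%N
            = f_skew lam (one_row a),
          prob_lt alpha beta
            = (e_lt alpha beta)%:R / (e (cell_poset lam))%:R
        & (e_lt alpha beta)%:R / (e (cell_poset lam))%:R
            = (f_skew lam (one_row a))%:R / (f_shape lam)%:R :> rat],
      (l2 <= a)%N ->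
        (f_skew lam (one_row a))%:R
          = (l1 + l2 - a)`!%:R / ((l1 - a)`!%:R * l2`!%:R) :> rat
        /\ (f_skew lam (one_row a))%:R / (f_shape lam)%:R
          = ((l1 + l2 - a)`!%:R * (l1 + 1)`!%:R)
            / ((l1 - a)`!%:R * (l1 + l2)`!%:R * (1 + l1 - l2)%:R) :> rat
    & (a < l2)%N ->
        (f_skew lam (one_row a))%:R
          = - (1 / ((l2 - a - 1)`!%:R * (l1 + 1)`!%:R)
               - 1 / ((l1 - a)`!%:R * l2`!%:R)) * (l1 + l2 - a)`!%:R :> rat
        /\ (f_skew lam (one_row a))%:R / (f_shape lam)%:R
          = (((l1 + 1)%:R * (l2 - a - 1)`!%:R * l1`!%:R
              - l2%:R * (l1 - a)`!%:R * (l2 - 1)`!%:R) * (l1 + l2 - a)`!%:R)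
            / ((l1 - l2 + 1)%:R * (l1 - a)`!%:R * (l2 - a - 1)`!%:R
               * (l1 + l2)`!%:R) :> rat].
Proof.
move=> lam alpha beta.
have f0 n : n`!%:R != 0 :> rat by rewrite pnatr_eq0 -lt0n fact_gt0.
have row1 : f_shape (one_row (a - 1)) = 1%N.
  have := @orderings_skew_cells (a - 1) 0 0 0 isT isT.
  by rewrite -f_shapeE // !bin0 bin_small ?addn0 //; lia.
have elt : e_lt alpha beta = f_skew lam (one_row a) by apply: e_lt_cell.
split.
- by rewrite /prob_lt row1 mul1n elt.
- move=> l2a; have fE : (f_skew lam (one_row a))%:R
      = (l1 + l2 - a)`!%:R / ((l1 - a)`!%:R * l2`!%:R) :> rat.
    (* With [l2 <= a] there are no bad paths: [l1 + l2 - a < l1.+1]. *)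
    rewrite f_skew_one_row // (@bin_small _ l1.+1) ?subr0; last lia.
    rewrite bin_factE; last lia.
    have -> : (l1 + l2 - a - l2 = l1 - a)%N by lia.
    by rewrite [X in _ / X = _]mulrC.
  split=> //; rewrite fE f_shape_two_rows // (addn1 l1).
  have -> : (1 + l1 - l2 = l1 - l2 + 1)%N by lia.
  field.
  by rewrite !f0 natr1 pnatr_eq0.
move=> al2; have fE : (f_skew lam (one_row a))%:R
    = - (1 / ((l2 - a - 1)`!%:R * (l1 + 1)`!%:R)
         - 1 / ((l1 - a)`!%:R * l2`!%:R)) * (l1 + l2 - a)`!%:R :> rat.
  (* With [a < l2], [l1.+1 <= l1 + l2 - a], so both binomials expand into factorials. *)
  rewrite f_skew_one_row // !bin_factE; try lia.
  have -> : (l1 + l2 - a - l2 = l1 - a)%N by lia.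
  have -> : (l1 + l2 - a - l1.+1 = l2 - a - 1)%N by lia.
  by rewrite addn1; field; rewrite !f0.
split=> //; rewrite fE f_shape_two_rows // (addn1 l1).
(* The target is written with the factorial of [l2 - 1], which [field] would treat as unrelated to
   that of [l2]. *)
have -> : l2`! = (l2 * (l2 - 1)`!)%N.
  by case: (l2) (hl2) => // k _; rewrite subn1 factS.
rewrite factS !natrM; field.
by rewrite !f0 ?nat1r ?natr1 ?pnatr_eq0; lia.
Qed.
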